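(* Let $Q$ be a finite non-connected non-projection subdirectly irreducible medial quandle. Then $Q$ is reductive.
   Context: A quandle is an algebra $(Q,\ast,\backslash)$ with two binary operations such that for all $x,y,z\in Q$: $x\ast x=x$; $x\ast(y\ast z)=(x\ast y)\ast(x\ast z)$; $x\backslash(x\ast y)=y=x\ast(x\backslash y)$. It is medial if for all $x,y,u,v$: $(x\ast y)\ast(u\ast v)=(x\ast u)\ast(y\ast v)$, $(x\backslash y)\backslash(u\backslash v)=(x\backslash u)\backslash(y\backslash v)$ and $(x\backslash y)\ast(u\backslash v)=(x\ast u)\backslash(y\ast v)$. Let $L_a\colon x\mapsto a\ast x$. The orbits of $Q$ are the orbits of the permutation group generated by all $L_a$, $a\in Q$; $Q$ is connected if it has only one orbit. A projection quandle is one satisfying $x\ast y=y$ for all $x,y$. An algebra is subdirectly irreducible if the intersection of all its non-trivial congruences (congruences different from equality) is non-trivial. For $m\ge 1$, a quandle is $m$-reductive if it satisfies the identity $(((x\ast y)\ast y)\ast\cdots)\ast y\approx y$ with $m$ occurrences of $y$ on the left-hand side; it is reductive if it is $m$-reductive for some $m\ge 1$. *)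

(* Defs.v *)
From mathcomp Require Import all_boot all_fingroup.
From Corelib Require RelationClasses.

Set Implicit Arguments.
Unset Strict Implicit.
Unset Printing Implicit Defensive.

Record quandle (T : Type) := Quandle {
  qmul : T -> T -> T;
  qldiv : T -> T -> T;
  qmulxx : forall x, qmul x x = x;
  qmul_distl : forall x y z, qmul x (qmul y z) = qmul (qmul x y) (qmul x z);
  qmulK : forall x y, qldiv x (qmul x y) = y;
  qldivK : forall x y, qmul x (qldiv x y) = y
}.

Declare Scope quandle_scope.
Delimit Scope quandle_scope with Q.
Notation "x *[ Q ] y" := (qmul Q x y)
  (at level 40, left associativity, format "x  *[ Q ]  y") : quandle_scope.
Notation "x \[ Q ] y" := (qldiv Q x y)
  (at level 40, left associativity, format "x  \[ Q ]  y") : quandle_scope.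
Local Open Scope quandle_scope.

Definition medial (T : Type) (Q : quandle T) : Prop :=
  [/\ forall x y u v : T,
        (x *[Q] y) *[Q] (u *[Q] v) = (x *[Q] u) *[Q] (y *[Q] v),
      forall x y u v : T,
        (x \[Q] y) \[Q] (u \[Q] v) = (x \[Q] u) \[Q] (y \[Q] v)
    & forall x y u v : T,
        (x \[Q] y) *[Q] (u \[Q] v) = (x *[Q] u) \[Q] (y *[Q] v)].

Definition projection (T : Type) (Q : quandle T) : Prop :=
  forall x y : T, x *[Q] y = y.

Lemma qmul_inj (T : Type) (Q : quandle T) (a : T) : injective (qmul Q a).
Proof. exact: can_inj (qmulK Q a). Qed.

Definition left_translation (T : finType) (Q : quandle T) (a : T) : {perm T} :=
  perm (@qmul_inj T Q a).

Definition left_mul_group (T : finType) (Q : quandle T) : {group {perm T}} :=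
  <<[set left_translation Q a | a : T]>>%G.

Definition orbits (T : finType) (Q : quandle T) : {set {set T}} :=
  [set orbit 'P (left_mul_group Q) x | x : T].

(* The empty quandle has no orbit and so is not connected; it is a projection
   quandle. *)
Definition connected (T : finType) (Q : quandle T) : Prop :=
  #|orbits Q| = 1.

Definition congruence (T : Type) (Q : quandle T) (R : T -> T -> Prop) : Prop :=
  [/\ RelationClasses.Equivalence R,
      forall x x' y y' : T, R x x' -> R y y' -> R (x *[Q] y) (x' *[Q] y')
    & forall x x' y y' : T, R x x' -> R y y' -> R (x \[Q] y) (x' \[Q] y')].

Definition nontrivial (T : Type) (R : T -> T -> Prop) : Prop :=
  ~ (forall x y : T, R x y <-> x = y).

(* On a one-element quandle there is no non-trivial congruence, so the
   intersection is the full relation, which is equality: such a quandle is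
   not subdirectly irreducible. *)
Definition subdirectly_irreducible (T : Type) (Q : quandle T) : Prop :=
  nontrivial (fun x y : T =>
    forall R : T -> T -> Prop, congruence Q R -> nontrivial R -> R x y).

Definition m_reductive (T : Type) (Q : quandle T) (m : nat) : Prop :=
  forall x y : T, iter m (fun z => z *[Q] y) x = y.

Definition reductive (T : Type) (Q : quandle T) : Prop :=
  exists2 m : nat, 1 <= m & m_reductive Q m.

(* Main.v *)
Require Import Defs.
From mathcomp Require Import all_boot all_fingroup.

(** Let [D] be the displacement group, generated by the [L_a^-1 L_b]. For a
    medial quandle [D] is abelian, so conjugation by [L_a] acts on [D] as an
    automorphism [t] that does not depend on [a]. Some positive power [p] of
    [1 - t] is idempotent, and [D = ker p (+) im p] (Fitting). Point
    stabilisers in [D] are stable under [1 - t], so the congruences whose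
    classes are the orbits of [ker p] and of [im p] meet trivially, and
    subdirect irreducibility makes one of the two subgroups trivial.
    If [im p = 1], then [1 - t] is nilpotent; since
    [(d y) * y = ((1 - t) d) y], the quandle is reductive.
    If [ker p = 1], then [1 - t] is bijective on [D]. Then [L_x = L_y] never
    holds for distinct [x], [y] in one orbit, so the congruence [L_x = L_y]
    meets the orbit congruence trivially and one of them is the equality. If it
    is the orbit congruence, the quandle is a projection. Otherwise [L] is
    injective, and solving [(1 - t) g = L_e^-1 L_a] gives [L_a = L_(g e)],
    hence [a = g e]: the quandle is connected. *)

Set Implicit Arguments.
Unset Strict Implicit.
Unset Printing Implicit Defensive.

Import GroupScope.
Local Open Scope quandle_scope.
Local Open Scope group_scope.

(** * An idempotent power of a self-map of a finite set *)

Lemma iter_idempotent (X : finType) (f : X -> X) :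
  exists2 n, 0 < n & forall x, iter n f (iter n f x) = iter n f x.
Proof.
(* The factorial is at least every pre-period and a multiple of every cycle length, so one exponent
   serves all [x]. *)
exists #|X|`!; first exact: fact_gt0.
move=> x; have /trajectP[i lt_io def_i] := looping_order f x.
set o := fingraph.order f x in lt_io def_i.
have le_oX : o <= #|X| by apply: max_card.
have le_iX : i <= #|X|`!.
  apply: leq_trans (leq_trans (ltnW lt_io) le_oX) _.
  by case: #|X| => // n; rewrite factS leq_pmulr ?fact_gt0.
have step m : i <= m -> iter (o - i + m) f x = iter m f x.
  move=> le_im; rewrite -(subnK le_im) addnCA iterD subnK 1?ltnW //.
  by rewrite def_i -iterD.
have period k : iter (k * (o - i) + #|X|`!) f x = iter #|X|`! f x.
  elim: k => // k IHk; rewrite mulSn -addnA step //.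
  exact: leq_trans (leq_addl _ _).
have /dvdnP[k def_k] : o - i %| #|X|`!.
  by rewrite dvdn_fact // subn_gt0 lt_io (leq_trans (leq_subr _ _)).
by rewrite -iterD {1}def_k period.
Qed.

(** * Left translations and the displacement group *)

Section FiniteMedialQuandle.

Variables (T : finType) (Q : quandle T).

Let L := left_translation Q.

Lemma left_translationE a x : L a x = a *[Q] x.
Proof. by rewrite permE. Qed.

Lemma left_translationV a x : (L a)^-1 x = a \[Q] x.
Proof. by apply: (@perm_inj _ (L a)); rewrite permKV permE qldivK. Qed.

Lemma left_translation_mul a b : L (a *[Q] b) = L b ^ L a.
Proof.
apply/permP=> x; rewrite -[x](permKV (L a)) permJ !left_translationE.
by rewrite -qmul_distl.
Qed.

Lemma left_translation_ldiv a b : L (a \[Q] b) = L b ^ (L a)^-1.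
Proof. by rewrite -{2}(qldivK Q a b) left_translation_mul conjgK. Qed.

Definition displacement_group : {group {perm T}} :=
  <<[set ((L u.1)^-1 * L u.2)%g | u : T * T]>>%G.

Let D := displacement_group.

Lemma mem_displacement a b : (L a)^-1 * L b \in D.
Proof. by apply: mem_gen; apply/imsetP; exists (a, b). Qed.

Lemma displacement_sub_left_mul : D \subset left_mul_group Q.
Proof.
rewrite gen_subG; apply/subsetP=> _ /imsetP[[a b] _ ->] /=.
by rewrite groupM ?groupV // mem_gen // imset_f.
Qed.

Lemma left_translation_norm a : L a \in 'N(D).
Proof.
apply: (subsetP (norm_gen _)); rewrite inE; apply/subsetP=> _ /imsetP[d + ->].
case/imsetP=> -[x y] _ ->; rewrite conjMg conjVg -!left_translation_mul.
by apply/imsetP; exists (a *[Q] x, a *[Q] y).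
Qed.

Lemma left_translation_act g x : g \in left_mul_group Q -> L (g x) = L x ^ g.
Proof.
move=> /gen_prodgP[n [c c_in ->]]; elim: n c c_in x => [|n IHn] c c_in x.
  by rewrite big_ord0 perm1 conjg1.
rewrite big_ord_recr /= permM conjgM -IHn //.
have /imsetP[a _ ->] := c_in ord_max.
by rewrite left_translationE left_translation_mul.
Qed.

Lemma displacement_act d x : d \in D -> L (d x) = L x ^ d.
Proof.
move=> Dd; apply: left_translation_act.
exact: (subsetP displacement_sub_left_mul).
Qed.

(** * Congruences and subdirect irreducibility *)

Lemma orbit_congruence (K : {group {perm T}}) :
  K \subset D -> (forall a, L a \in 'N(K)) ->
  congruence Q (fun x y => exists2 d, d \in K & x = d y).
Proof.
move=> sKD nKL; split.
- split.
  + by move=> x; exists 1; rewrite ?group1 ?perm1.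
  + by move=> x y [d Kd ->]; exists d^-1; rewrite ?groupV ?permK.
  + move=> x y z [d Kd ->] [d' Kd' ->].
    by exists (d' * d); rewrite ?groupM ?permM.
- move=> _ x _ y [d Kd ->] [k Kk ->].
  (* Composition runs left to right: [k * L x ^ d = L x * ((k * d^-1) ^ L x * d)]. Division uses
     [(L x)^-1] in the same way. *)
  exists ((k * d^-1) ^ L x * d).
    by rewrite groupM // memJ_norm // groupM ?groupV.
  rewrite -!left_translationE displacement_act ?(subsetP sKD) //.
  by rewrite !conjgE -!permM !mulgA mulgV mul1g.
- move=> _ x _ y [d Kd ->] [k Kk ->].
  exists ((k * d^-1) ^ (L x)^-1 * d).
    by rewrite groupM // memJ_norm ?groupV // groupM ?groupV.
  rewrite -!left_translationV displacement_act ?(subsetP sKD) // -conjVg.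
  by rewrite !conjgE -!permM !invgK !mulgA mulVg mul1g.
Qed.

Lemma orbit_congruence_nontrivial (K : {group {perm T}}) :
  K :!=: 1 -> nontrivial (fun x y => exists2 d, d \in K & x = d y).
Proof.
move/eqP=> ntK trivR; apply/ntK/trivgP/subsetP=> d Kd.
by apply/set1P/permP=> x; rewrite perm1; apply/trivR; exists d.
Qed.

Lemma left_translation_congruence : congruence Q (fun x y => L x = L y).
Proof.
split; first by split=> // x y z ->.
  by move=> x x' y y' eq_x eq_y; rewrite !left_translation_mul eq_x eq_y.
by move=> x x' y y' eq_x eq_y; rewrite !left_translation_ldiv eq_x eq_y.
Qed.

Lemma subdirectly_irreducible_meet (R S : T -> T -> Prop) :
  subdirectly_irreducible Q -> congruence Q R -> congruence Q S ->
  nontrivial R -> nontrivial S -> (forall x y, R x y -> S x y -> x = y) ->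
  False.
Proof.
move=> siQ congR congS ntR ntS meetRS; apply: siQ => x y; split.
  by move=> inter; apply: meetRS; apply: inter.
by move=> -> U [[reflU _ _] _ _] _; apply: reflU.
Qed.

(** * Consequences of mediality *)

Hypothesis medQ : medial Q.

Lemma left_translation_medial a b c :
  L a * (L b)^-1 * L c = L c * (L b)^-1 * L a.
Proof.
have [med _ _] := medQ.
have eq_ab : L a * L (b *[Q] c) = L c * L (b *[Q] a).
  by apply/permP=> x; rewrite !permM !left_translationE med.
apply: (mulIg (L b)); rewrite !left_translation_mul !conjgE !mulgA in eq_ab *.
exact: eq_ab.
Qed.

(** Exchanging outer factors turns [L_a^-1 L_b L_c^-1 L_d] into [L_c^-1 L_b L_a^-1 L_d], then into
    [L_c^-1 L_d L_a^-1 L_b]. *)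
Lemma displacement_abelian : abelian D.
Proof.
rewrite abelian_gen; apply/centsP.
move=> _ /imsetP[[a b] _ ->] _ /imsetP[[c d] _ ->] /=.
have medV u v w : (L u)^-1 * L v * (L w)^-1 = (L w)^-1 * L v * (L u)^-1.
  by apply: invg_inj; rewrite !invMg !invgK !mulgA left_translation_medial.
rewrite /commute !mulgA medV -!mulgA; congr (_ * _).
by rewrite !mulgA left_translation_medial.
Qed.

(** * The endomorphism [1 - t] and its action on points *)

Section BasePoint.

Variable e : T.

Lemma displacement_conj a d : d \in D -> d ^ L a = d ^ L e.
Proof.
move=> Dd; rewrite -[L a](mulKVg (L e)) conjgM; apply/conjg_fixP/commgP.
apply: (centsP displacement_abelian); last exact: mem_displacement.
by rewrite memJ_norm ?left_translation_norm.
Qed.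

(* The endomorphism [1 - t] of [D], written multiplicatively. *)
Definition one_sub_conj (d : {perm T}) : {perm T} := d * (d ^ L e)^-1.

Let f := one_sub_conj.

Lemma one_sub_conj_closed d : d \in D -> f d \in D.
Proof.
by move=> Dd; rewrite groupM ?groupV ?memJ_norm ?left_translation_norm.
Qed.

Lemma iter_one_sub_conj_closed n d : d \in D -> iter n f d \in D.
Proof. by move=> Dd; elim: n => //= n; apply: one_sub_conj_closed. Qed.

Lemma one_sub_conjM : {in D &, {morph f : d g / d * g}}.
Proof.
move=> d g Dd Dg; rewrite /f /one_sub_conj conjMg invMg !mulgA.
have cD := centsP displacement_abelian.
have Dt h : h \in D -> (h ^ L e)^-1 \in D.
  by move=> Dh; rewrite groupV memJ_norm ?left_translation_norm.
by rewrite -!mulgA; congr (_ * _); rewrite !mulgA cD ?mulgA ?groupM ?Dt.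
Qed.

Lemma iter_one_sub_conjM n : {in D &, {morph iter n f : d g / d * g}}.
Proof.
move=> d g Dd Dg; elim: n => //= n ->.
by rewrite one_sub_conjM ?iter_one_sub_conj_closed.
Qed.

Lemma iter_one_sub_conj1 n : iter n f 1 = 1.
Proof. by elim: n => //= n ->; rewrite /f /one_sub_conj conj1g invg1 mulg1. Qed.

Lemma iter_one_sub_conjV n : {in D, {morph iter n f : d / d^-1}}.
Proof.
move=> d Dd; apply: (mulgI (iter n f d)).
by rewrite -iter_one_sub_conjM ?groupV // !mulgV iter_one_sub_conj1.
Qed.

Lemma iter_one_sub_conjJ n d a :
  d \in D -> iter n f (d ^ L a) = iter n f d ^ L a.
Proof.
move=> Dd; rewrite (displacement_conj a Dd).
rewrite (displacement_conj a (iter_one_sub_conj_closed n Dd)).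
elim: n => //= n ->; move: (iter n f d) => g.
by rewrite /f /one_sub_conj [RHS]conjMg conjVg.
Qed.

(** Since [L y] fixes [y], the conjugate [d ^ L y], equal to [d ^ L e], fixes [y] whenever [d]
    does. *)
Lemma iter_one_sub_conj_stab n d y : d \in D -> d y = y -> iter n f d y = y.
Proof.
move=> Dd dy; elim: n => //= n IHn; set g := iter n f d in IHn *.
have Dg : g \in D by apply: iter_one_sub_conj_closed.
rewrite /f /one_sub_conj -(displacement_conj y Dg) permM IHn.
have Ly : L y y = y by rewrite left_translationE qmulxx.
by apply: (canLR (permK _)); rewrite -{3}Ly permJ IHn Ly.
Qed.

(** As [D] is abelian, [f d = (L y)^-1 * L (d y)], and [L y] fixes [y]. This turns repeated right
    multiplication by [y] into iteration of [f]. *)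
Lemma displacement_qmul d y : d \in D -> d y *[Q] y = f d y.
Proof.
move=> Dd; rewrite -left_translationE displacement_act //.
rewrite /f /one_sub_conj -(displacement_conj y Dd).
have Ly : (L y)^-1 y = y by rewrite left_translationV -{2}(qmulxx Q y) qmulK.
have Dt : (d ^ L y)^-1 \in D by rewrite groupV memJ_norm ?left_translation_norm.
rewrite (centsP displacement_abelian _ Dd _ Dt) -{2}Ly -permM.
by rewrite !conjgE !invMg invgK !mulgA.
Qed.

Lemma left_translation_one_sub_conj d : d \in D -> L (d e) = L e * f d.
Proof.
move=> Dd; rewrite displacement_act // /f /one_sub_conj.
have De : (d ^ L e)^-1 \in D.
  by rewrite groupV memJ_norm ?left_translation_norm.
rewrite (centsP displacement_abelian _ Dd _ De).
by rewrite !conjgE !invMg invgK !mulgA mulgV mul1g.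
Qed.

(** Equality of the two translations says that [d] commutes with [L y]. *)
Lemma one_sub_conj_fix d y : d \in D -> L (d y) = L y -> f d = 1.
Proof.
move=> Dd; rewrite displacement_act // => /conjg_fixP/commgP comm.
by rewrite /f /one_sub_conj -(displacement_conj y Dd) conjgE -comm mulKg mulgV.
Qed.

Lemma iter_one_sub_conj_reductive n :
  {in D, forall d, iter n f d = 1} -> m_reductive Q n.+1.
Proof.
move=> nilf x y; rewrite iterSr.
(* The first product brings [x] into the [D]-orbit of [y]; this is the extra step in [n.+1]. *)
have -> : x *[Q] y = ((L y)^-1 * L x) y.
  by rewrite permM left_translationV -{3}(qmulxx Q y) qmulK left_translationE.
have Dd := mem_displacement y x; move: (_ * _) Dd => d Dd.
have -> : iter n (fun z => z *[Q] y) (d y) = iter n f d y.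
  elim: n {nilf} => //= n ->.
  by rewrite displacement_qmul ?iter_one_sub_conj_closed.
by rewrite nilf // perm1.
Qed.

Lemma one_sub_conj_surj_connected :
  injective L -> {in D, forall d, exists2 g, g \in D & f g = d} ->
  connected Q.
Proof.
move=> injL surjf; have e_trans a : a \in orbit 'P (left_mul_group Q) e.
  have [g Dg fg] := surjf _ (mem_displacement e a).
  apply/orbitP; exists g; first exact: (subsetP displacement_sub_left_mul).
  by apply: injL; rewrite /= /aperm left_translation_one_sub_conj // fg mulKVg.
apply/eqP/cards1P; exists (orbit 'P (left_mul_group Q) e).
apply/setP=> A; rewrite inE; apply/imsetP/eqP => [[x _ ->]|->].
  by apply/orbit_eqP; apply: e_trans.
by exists e.
Qed.

(** * The Fitting decomposition of [D] *)

Section Fitting.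

Variable n : nat.

Definition fitting_null_set : {set {perm T}} := [set d in D | iter n f d == 1].

Lemma fitting_null_group_set : group_set fitting_null_set.
Proof.
apply/group_setP; split; first by rewrite inE group1 iter_one_sub_conj1 eqxx.
move=> d g; rewrite !inE => /andP[Dd /eqP d1] /andP[Dg /eqP g1].
by rewrite groupM // iter_one_sub_conjM // d1 g1 mulg1 eqxx.
Qed.
Canonical fitting_null := Group fitting_null_group_set.

(** When [iter n f] is idempotent, its fixed points form its image. *)
Definition fitting_one_set : {set {perm T}} := [set d in D | iter n f d == d].

Lemma fitting_one_group_set : group_set fitting_one_set.
Proof.
apply/group_setP; split; first by rewrite inE group1 iter_one_sub_conj1 eqxx.
move=> d g; rewrite !inE => /andP[Dd /eqP d1] /andP[Dg /eqP g1].
by rewrite groupM // iter_one_sub_conjM // d1 g1 eqxx.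
Qed.
Canonical fitting_one := Group fitting_one_group_set.

Lemma fitting_null_norm a : L a \in 'N(fitting_null).
Proof.
rewrite inE; apply/subsetP=> _ /imsetP[d /setIdP[Dd /eqP d1] ->].
rewrite inE memJ_norm ?left_translation_norm // Dd.
by rewrite iter_one_sub_conjJ // d1 conj1g /=.
Qed.

Lemma fitting_one_norm a : L a \in 'N(fitting_one).
Proof.
rewrite inE; apply/subsetP=> _ /imsetP[d /setIdP[Dd /eqP d1] ->].
rewrite inE memJ_norm ?left_translation_norm // Dd.
by rewrite iter_one_sub_conjJ // d1 /=.
Qed.

(** If [k y = i y], then [k * i^-1] fixes [y], hence so does its image [i^-1] under [iter n f]. *)
Lemma fitting_meet x y :
  (exists2 d, d \in fitting_null & x = d y) ->
  (exists2 d, d \in fitting_one & x = d y) -> x = y.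
Proof.
move=> [k /setIdP[Dk /eqP k1] def_x] [i /setIdP[Di /eqP i1] def_x'].
have := @iter_one_sub_conj_stab n (k * i^-1) y.
rewrite groupM ?groupV // permM -def_x def_x' permK => /(_ isT erefl).
rewrite iter_one_sub_conjM ?groupV // iter_one_sub_conjV // k1 i1 mul1g.
by move=> iy; rewrite -{1}iy permKV.
Qed.

Lemma fitting_trivial :
  subdirectly_irreducible Q -> fitting_null :=: 1 \/ fitting_one :=: 1.
Proof.
move=> siQ; have [|nt0] := eqVneq (gval fitting_null) 1; first by left.
have [|nt1] := eqVneq (gval fitting_one) 1; first by right.
have sub0 : fitting_null \subset D by apply/subsetP=> d /setIdP[].
have sub1 : fitting_one \subset D by apply/subsetP=> d /setIdP[].
case: (subdirectly_irreducible_meet siQ _ _ _ _ fitting_meet).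
- exact: orbit_congruence sub0 fitting_null_norm.
- exact: orbit_congruence sub1 fitting_one_norm.
- exact: orbit_congruence_nontrivial.
- exact: orbit_congruence_nontrivial.
Qed.

End Fitting.

(** * Injective [1 - t], and the conclusion *)

Lemma one_sub_conj_injective_dichotomy :
  subdirectly_irreducible Q -> {in D, forall d, f d = 1 -> d = 1} ->
  projection Q \/ injective L.
Proof.
move=> siQ injf; have [D1|ntD] := eqVneq (D : {set _}) 1.
  (* With [D] trivial all translations coincide, so [x * y = y * y = y]. *)
  left=> x y; have := mem_displacement y x; rewrite D1 => /set1P.
  move/(canRL (mulKVg _)); rewrite mulg1 -left_translationE => ->.
  by rewrite left_translationE qmulxx.
right; apply/injectiveP/idPn=> not_injL.
apply: (subdirectly_irreducible_meet siQ left_translation_congruence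
         (orbit_congruence (subxx D) left_translation_norm) _
         (orbit_congruence_nontrivial ntD)).
  move=> trivL; case/injectiveP: not_injL => x y eqL; exact/trivL.
move=> x y eqL [d Dd def_x]; move: eqL; rewrite def_x.
by move=> /(one_sub_conj_fix Dd)/(injf _ Dd) ->; rewrite perm1.
Qed.

End BasePoint.

End FiniteMedialQuandle.

Theorem theorem4p7 (T : finType) (Q : quandle T) :
  medial Q -> ~ connected Q -> ~ projection Q -> subdirectly_irreducible Q ->
  reductive Q.
Proof.
move=> medQ not_conn not_proj siQ.
have [e _ | T0] := pickP (@predT T); last by exists 1%N => // x; have := T0 x.
pose f := one_sub_conj Q e; pose D := displacement_group Q.
have [n n_gt0 idem_f] := iter_idempotent f.
have [null1|one1] := fitting_trivial medQ e n siQ; last first.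
  exists n.+1 => //; apply: (iter_one_sub_conj_reductive medQ (e := e)) => d Dd.
  have : iter n f d \in fitting_one medQ e n.
    by rewrite inE iter_one_sub_conj_closed //= idem_f.
  by rewrite one1 => /set1P.
have injp d : d \in D -> iter n f d = 1 -> d = 1.
  move=> Dd d1; have : d \in fitting_null medQ e n by rewrite inE Dd d1 /=.
  by rewrite null1 => /set1P.
have [|//|injL] := one_sub_conj_injective_dichotomy medQ (e := e) siQ.
  move=> d Dd fd1; apply: injp => //; rewrite -(prednK n_gt0) iterSr.
  by rewrite -/f in fd1; rewrite fd1 iter_one_sub_conj1.
case: not_conn; apply: (one_sub_conj_surj_connected medQ (e := e) injL) => d Dd.
(* Write [p = iter n f]. Idempotence gives [p (d * (p d)^-1) = 1], so injectivity yields [d = p d],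
   which is [f] of this witness. *)
exists (iter n.-1 f d); first exact: iter_one_sub_conj_closed.
rewrite -/f -iterS (prednK n_gt0); apply: invg_inj.
apply: (mulgI d); rewrite mulgV; apply: injp.
  by rewrite groupM ?groupV ?iter_one_sub_conj_closed.
have Dp := iter_one_sub_conj_closed e n Dd.
by rewrite iter_one_sub_conjM ?iter_one_sub_conjV ?groupV // idem_f mulgV.
Qed.
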